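(* Let $k\ge 2$ and let $M_1^{k-1}$ and $M_2^{k-1}$ be compact immersed minimal hypersurfaces of $S^k$. Then for every $\nu\in S^k$, $$M_1\cap M_2\cap \overline{H_+(\nu)}\neq\emptyset,$$ where $\overline{H_+(\nu)}=\{p\in S^k:\langle p,\nu\rangle\ge 0\}$ is the closed hemisphere in the direction of $\nu$.
   Context: $S^k\subset\mathbb{R}^{k+1}$ is the unit sphere with its standard round metric, and $\langle\cdot,\cdot\rangle$ is the Euclidean inner product of $\mathbb{R}^{k+1}$. All manifolds are connected, complete and without boundary. An immersed hypersurface $M^{k-1}$ of $S^k$ is a $(k-1)$-dimensional manifold with an immersion into $S^k$; when intersections of hypersurfaces with other sets are taken, $M$ is identified with the image of the immersion. With $N$ a (local) unit normal field along $M$ and $\{e_i\}_{i=1}^{k-1}$ a local orthonormal frame tangent to $M$, the mean curvature is $H=\frac{1}{k-1}\sum_{i=1}^{k-1}\langle D_{e_i}N,e_i\rangle$; $M$ is minimal if $H$ vanishes identically. *)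

(* Defs.v *)
From HB Require Import structures.
From mathcomp Require Import all_boot all_order all_algebra.
From mathcomp Require Import all_classical all_reals all_analysis.
Import Order.TTheory GRing.Theory Num.Theory.
Import numFieldNormedType.Exports.

Set Implicit Arguments.
Unset Strict Implicit.
Unset Printing Implicit Defensive.

Local Open Scope classical_set_scope.
Local Open Scope ring_scope.

Definition dotp (R : realType) (n : nat) (u v : 'rV[R]_n) : R :=
  \sum_(i < n) u 0 i * v 0 i.

(* The unit sphere of dimension k. *)
Definition usphere (R : realType) (k : nat) : set 'rV[R]_k.+1 :=
  [set p | dotp p p = 1].

Definition closed_hemisphere (R : realType) (k : nat) (nu : 'rV[R]_k.+1) :
    set 'rV[R]_k.+1 :=
  [set p | usphere p /\ 0 <= dotp p nu].

Definition partial (R : realType) (n m : nat) (i : 'I_n)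
    (f : 'rV[R]_n -> 'rV[R]_m) : 'rV[R]_n -> 'rV[R]_m :=
  'D_(delta_mx 0 i) f.

Definition iter_partial (R : realType) (n m : nat) (s : seq 'I_n)
    (f : 'rV[R]_n -> 'rV[R]_m) : 'rV[R]_n -> 'rV[R]_m :=
  foldr (fun i g => partial i g) f s.

(* C^infinity on V: partial derivatives of all orders exist and are continuous.
   Derivatives of the total function f at a point of V are two-sided, so this
   is meant for V open, where it only depends on the values of f on V. *)
Definition smooth_on (R : realType) (n m : nat) (V : set 'rV[R]_n)
    (f : 'rV[R]_n -> 'rV[R]_m) : Prop :=
  forall s : seq 'I_n,
    {in V, continuous (iter_partial s f)} /\
    (forall (i : 'I_n) (x : 'rV[R]_n), V x ->
       derivable (iter_partial s f) x (delta_mx 0 i)).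

(* The values of chart_map off chart_dom, and of chart_inv off chart_img, are
   irrelevant. *)
Record chart (R : realType) (n : nat) (T : topologicalType) := Chart {
  chart_dom : set T ;
  chart_img : set 'rV[R]_n ;
  chart_map : T -> 'rV[R]_n ;
  chart_inv : 'rV[R]_n -> T ;
  chart_dom_open : open chart_dom ;
  chart_img_open : open chart_img ;
  chart_map_bij : set_bij chart_dom chart_img chart_map ;
  chart_mapK : {in chart_dom, cancel chart_map chart_inv} ;
  chart_map_continuous : {in chart_dom, continuous chart_map} ;
  chart_inv_continuous : {in chart_img, continuous chart_inv} }.

(* Connected smooth manifolds without boundary, of dimension n; the atlas need
   not be maximal. *)
Record smooth_manifold (R : realType) (n : nat) := SmoothManifold {
  carrier :> topologicalType ;
  atlas : set (chart R n carrier) ;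
  manifold_hausdorff : hausdorff_space carrier ;
  manifold_second_countable : @second_countable carrier ;
  manifold_nonempty : [set: carrier] !=set0 ;
  manifold_connected : connected [set: carrier] ;
  atlas_cover : forall p : carrier, exists2 c, atlas c & chart_dom c p ;
  atlas_compatible : forall c d, atlas c -> atlas d ->
    smooth_on (chart_img c `&` chart_inv c @^-1` chart_dom d)
      (chart_map d \o chart_inv c) }.

Definition immersion (R : realType) (n m : nat) (M : smooth_manifold R n)
    (F : M -> 'rV[R]_m) : Prop :=
  forall c, atlas c ->
    smooth_on (chart_img c) (F \o chart_inv c) /\
    (forall x, chart_img c x -> injective ('d (F \o chart_inv c) x)).

(* The sphere being an embedded submanifold of the Euclidean space, immersions
   into the sphere are the immersions into the Euclidean space with values in
   the sphere. *)
Definition immersed_hypersurface (R : realType) (k : nat)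
    (M : smooth_manifold R k.-1) (F : M -> 'rV[R]_k.+1) : Prop :=
  (forall p, usphere (F p)) /\ immersion F.

(* In what follows f : R^(k-1) -> S^k is a local parametrization of the
   hypersurface, and fields along the hypersurface are functions of the
   coordinates. *)

Definition unit_normal_field (R : realType) (k : nat) (W : set 'rV[R]_k.-1)
    (f N : 'rV[R]_k.-1 -> 'rV[R]_k.+1) : Prop :=
  smooth_on W N /\
  (forall x, W x ->
    [/\ dotp (N x) (N x) = 1, dotp (N x) (f x) = 0 &
        forall v, dotp (N x) ('d f x v) = 0]).

(* The frame is e_i = df (E_i), given by its coordinate expression E. *)
Definition orthonormal_frame (R : realType) (k : nat) (W : set 'rV[R]_k.-1)
    (f : 'rV[R]_k.-1 -> 'rV[R]_k.+1)
    (E : 'I_k.-1 -> 'rV[R]_k.-1 -> 'rV[R]_k.-1) : Prop :=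
  (forall i, smooth_on W (E i)) /\
  (forall x, W x -> forall i j,
    dotp ('d f x (E i x)) ('d f x (E j x)) = (i == j)%:R).

(* Levi-Civita connection of the round sphere: the derivative at x, in the
   direction df(v), of the field N along f, projected orthogonally to the
   tangent space of the sphere at f x. *)
Definition sphere_connection (R : realType) (k : nat)
    (f N : 'rV[R]_k.-1 -> 'rV[R]_k.+1) (x v : 'rV[R]_k.-1) : 'rV[R]_k.+1 :=
  'D_v N x - dotp ('D_v N x) (f x) *: f x.

Definition mean_curvature (R : realType) (k : nat)
    (f N : 'rV[R]_k.-1 -> 'rV[R]_k.+1)
    (E : 'I_k.-1 -> 'rV[R]_k.-1 -> 'rV[R]_k.-1) (x : 'rV[R]_k.-1) : R :=
  (k.-1)%:R^-1 *
  \sum_(i < k.-1) dotp (sphere_connection f N x (E i x)) ('d f x (E i x)).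

(* h is the mean curvature at p of the hypersurface, computed with some choice
   of local unit normal field and of local orthonormal frame around p. Such
   choices always exist, and h is determined by p up to sign. *)
Definition mean_curvature_at (R : realType) (k : nat)
    (M : smooth_manifold R k.-1) (F : M -> 'rV[R]_k.+1) (p : M) (h : R) : Prop :=
  exists (c : chart R k.-1 M) (W : set 'rV[R]_k.-1)
    (N : 'rV[R]_k.-1 -> 'rV[R]_k.+1)
    (E : 'I_k.-1 -> 'rV[R]_k.-1 -> 'rV[R]_k.-1),
    let f := F \o chart_inv c in
    [/\ atlas c /\ chart_dom c p,
        [/\ open W, W `<=` chart_img c & W (chart_map c p)],
        unit_normal_field W f N,
        orthonormal_frame W f E &
        h = mean_curvature f N E (chart_map c p)].

Definition minimal_hypersurface (R : realType) (k : nat)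
    (M : smooth_manifold R k.-1) (F : M -> 'rV[R]_k.+1) : Prop :=
  immersed_hypersurface F /\ forall p, mean_curvature_at F p 0.

(* Main.v *)
(** Suppose that no common point of the images lies in the closed hemisphere
    u >= 0, where u = <., nu>; by compactness there is eps in (0, 1] with no
    common point in u >= -eps.  Multiplying the round metric by
    1 / (u + eps)^2 makes the cap u > -eps a complete space of constant
    curvature eps^2 - 1, in which the distance between x and y is an increasing
    function of
    (1 - <x, y>) / ((u(x) + eps) (u(y) + eps)).  Minimise this ratio over the
    parts of the two hypersurfaces inside the cap.  These parts are nonempty,
    because at a maximum of u on a minimal hypersurface the trace
    -(k - 1) u of the second variation is nonpositive.  The minimum c is
    positive and is not approached at the boundary of the cap, where the ratio
    blows up.  Then <x, y> + c (u(x) + eps) (u(y) + eps) has the maximal value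
    1 at the minimising pair.  The Euclidean reflection exchanging x and y maps
    the tangent space at x to the tangent space at y; moving both points along
    orthonormal frames that correspond under it, the second variations add up
    to (k - 1) c eps (u(x) + u(y) + 2 eps) > 0, which is absurd.  With
    eps = 0 the sum would vanish, as for two great spheres meeting in the
    equator of the hemisphere. *)

Require Import Defs.
From mathcomp Require Import all_boot all_order all_algebra.
From mathcomp Require Import all_classical all_reals all_analysis.
From mathcomp Require Import ring lra.
Import Order.TTheory GRing.Theory Num.Theory.
Import numFieldNormedType.Exports.

Set Implicit Arguments.
Unset Strict Implicit.
Unset Printing Implicit Defensive.

Local Open Scope classical_set_scope.
Local Open Scope ring_scope.

(** * Functions with continuous partial derivatives *)

Lemma is_derive_line (R : realType) (V W : normedModType R) (f : V -> W)
    (a v : V) (t : R) (df : W) :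
  is_derive (t *: v + a) v f df -> is_derive t 1 (fun s : R => f (s *: v + a)) df.
Proof.
move=> fd.
have E : (fun h : R => h^-1 *: (((fun s : R => f (s *: v + a)) \o shift t)
           (h *: (1 : R)) - f (t *: v + a))) =
         (fun h : R => h^-1 *: ((f \o shift (t *: v + a)) (h *: v) -
           f (t *: v + a))).
  by apply/funext => h /=; rewrite [h *: 1]mulr1 scalerDl addrA.
apply: DeriveDef.
  by rewrite /derivable E; exact: (@ex_derive _ _ _ _ _ _ _ fd).
by rewrite /derive E; exact: (@derive_val _ _ _ _ _ _ _ fd).
Qed.

Lemma is_derive_coord (R : realType) (V : normedModType R) (n : nat)
    (f : V -> 'rV[R]_n) (a v : V) (df : 'rV[R]_n) :
  is_derive a v f df <-> forall j, is_derive a v (fun x => f x 0 j) (df 0 j).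
Proof.
split=> [fd j|fd].
  have dv : derivable f a v by exact: ex_derive.
  apply: DeriveDef; first by move/derivable_mxP : dv.
  by rewrite -(@derive_val _ _ _ _ _ _ _ fd) (derive_mx dv) mxE.
have dv : derivable f a v by apply/derivable_mxP => i j; rewrite ord1; exact: ex_derive.
apply: DeriveDef => //; rewrite (derive_mx dv).
by apply/rowP => j; rewrite mxE; exact: derive_val.
Qed.

Lemma coord_le_norm (R : realType) (n : nat) (h : 'rV[R]_n) i : `|h 0 i| <= `|h|.
Proof.
rewrite [leRHS]/Num.Def.normr /= mx_normrE.
exact: (le_bigmax _ (fun ij => `|h ij.1 ij.2|) (0, i)).
Qed.

Lemma norm_le_coord (R : realType) (n : nat) (h : 'rV[R]_n) (C : R) :
  0 <= C -> (forall i, `|h 0 i| <= C) -> `|h| <= C.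
Proof.
move=> C0 hC; rewrite [leLHS]/Num.Def.normr /= mx_normrE.
by apply: bigmax_le => // -[i j] _ /=; rewrite ord1.
Qed.

(** Mean value theorem for [g] on the segment from [y] to [c *: v + y]; the last hypothesis keeps
    this whole segment in the ball around [x] where [pg] varies by at most [e]. *)
Lemma increment_along_le (R : realType) (V : normedModType R) (g : V -> R) (pg : V -> R)
    (x y v : V) (r c e : R) :
  (forall z, `|z - x| < r -> is_derive z v g (pg z)) ->
  (forall z, `|z - x| < r -> `|pg z - pg x| <= e) ->
  `|c| * `|v| + `|y - x| < r ->
  `|g (c *: v + y) - g y - c * pg x| <= `|c| * e.
Proof.
move=> dg ce yr.
pose phi (t : R) := g (t *: (c *: v) + y).
have inb (t : R) : t \in `[0, 1]%R -> `|(t * c) *: v + y - x| < r.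
  rewrite in_itv /= => /andP[t0 t1]; rewrite -addrA.
  apply: le_lt_trans (ler_normD _ _) _; apply: le_lt_trans yr.
  rewrite lerD2r normrZ normrM ler_wpM2r // ger0_norm //.
  by rewrite -[leRHS]mul1r ler_wpM2r.
have dphi (t : R) : t \in `[0, 1]%R ->
    is_derive t 1 phi (c * pg ((t * c) *: v + y)).
  move=> tI; rewrite /phi.
  have -> : (fun t => g (t *: (c *: v) + y)) =
      (fun s => g (s *: v + y)) \o (fun t : R => t * c).
    by apply/funext => s /=; rewrite scalerA.
  have d1 := is_derive_line (dg _ (inb t tI)).
  have d2 : is_derive t 1 (fun t : R => t * c) c.
    have := @is_deriveM _ _ id (cst c) t 1 1 0 (is_derive_id _ _) (is_derive_cst _ _ _).
    rewrite scaler0 add0r => d.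
    have e1 : cst c t *: (1 : R) = c by rewrite /cst [LHS]mulr1.
    exact: (is_derive_eq d e1).
  have d3 := @is_derive1_comp _ (fun s => g (s *: v + y)) _ t _ _ d1 d2.
  exact: (is_derive_eq d3 (mulrC _ _)).
have cphi : {within `[0, 1], continuous phi}.
  apply: derivable_within_continuous => t tI.
  by have := dphi _ tI => ?; exact: ex_derive.
have dphi' (t : R) : t \in `]0, 1[%R ->
    is_derive t 1 phi (c * pg ((t * c) *: v + y)).
  by move=> tI; apply: dphi; exact: subset_itv_oo_cc tI.
have [t tI] := MVT ltr01 dphi' cphi; rewrite subr0 mulr1 /phi scale1r scale0r add0r => ->.
rewrite -mulrBr normrM ler_wpM2l // ce // inb //.
exact: subset_itv_oo_cc tI.
Qed.

(** The increment is telescoped, changing one coordinate at a time. An arbitrary list [s] of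
    coordinates lets the induction run; the case of interest is the enumeration of all of them. *)
Lemma C1_increment (R : realType) (n : nat) (g : 'rV[R]_n -> R)
    (pg : 'I_n -> 'rV[R]_n -> R) (x h : 'rV[R]_n) (r e : R) (s : seq 'I_n) :
  (forall i z, `|z - x| < r -> is_derive z (delta_mx 0 i) g (pg i z)) ->
  (forall i z, `|z - x| < r -> `|pg i z - pg i x| <= e) ->
  (\sum_(i <- s) `|h 0 i|) < r ->
  `|g (\sum_(i <- s) h 0 i *: delta_mx 0 i + x) - g x -
    \sum_(i <- s) h 0 i * pg i x| <= (\sum_(i <- s) `|h 0 i|) * e.
Proof.
move=> dg ce; have nd i : `|delta_mx 0 i : 'rV[R]_n| <= 1.
  apply: norm_le_coord => // j; rewrite mxE eqxx /=.
  by case: (j == i); rewrite ?normr1 // normr0.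
have nS t : `|\sum_(i <- t) h 0 i *: (delta_mx 0 i : 'rV[R]_n)| <=
    \sum_(i <- t) `|h 0 i|.
  apply: le_trans (ler_norm_sum _ _ _) _; apply: ler_sum => i _.
  by rewrite normrZ ler_piMr.
elim: s => [|i s IHs].
  by rewrite !big_nil add0r !subrr normr0 mul0r.
rewrite !big_cons => hr.
have sr : \sum_(j <- s) `|h 0 j| < r by apply: le_lt_trans hr; rewrite lerDr.
rewrite -[_ *: _ + _ + x]addrA; set y := \sum_(j <- s) _ *: _ + x.
have step : `|g (h 0 i *: delta_mx 0 i + y) - g y - h 0 i * pg i x| <=
    `|h 0 i| * e.
  apply: (increment_along_le (dg i) (ce i)).
  apply: le_lt_trans hr; rewrite /y addrK lerD //.
  by rewrite ler_piMr.
rewrite mulrDl.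
have -> : g (h 0 i *: delta_mx 0 i + y) - g x -
    (h 0 i * pg i x + \sum_(j <- s) h 0 j * pg j x) =
  (g (h 0 i *: delta_mx 0 i + y) - g y - h 0 i * pg i x) +
  (g y - g x - \sum_(j <- s) h 0 j * pg j x) by ring.
apply: le_trans (ler_normD _ _) _; apply: lerD => //; exact: IHs.
Qed.

Lemma differentiable_near_bound (R : realType) (V W : normedModType R) (f : V -> W)
    (L : {linear V -> W}) (x : V) :
  continuous L ->
  (forall e : R, 0 < e ->
     \forall h \near 0, `|f (h + x) - f x - L h| <= e * `|h|) ->
  differentiable f x /\ 'd f x = L :> (V -> W).
Proof.
move=> Lc H.
have E : f \o shift x = cst (f x) + L +o_ 0 id.
  apply/eqaddoP => e e0; apply: filterS (H e e0) => h Hh.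
  by rewrite -[X in `|X| <= _]/(f (h + x) - (f x + L h)) opprD addrA.
have dE := diff_unique Lc E.
by split=> //; apply/diff_locallyP; rewrite dE.
Qed.

Lemma C1_differentiable (R : realType) (n m : nat) (f : 'rV[R]_n -> 'rV[R]_m)
    (x : 'rV[R]_n) :
  (\forall y \near x, forall i, derivable f y (delta_mx 0 i)) ->
  (forall i, {for x, continuous (partial i f)}) ->
  differentiable f x /\ (forall v, 'd f x v = \sum_i v 0 i *: partial i f x).
Proof.
move=> df cf.
pose J : 'M[R]_(n, m) := \matrix_i partial i f x.
have JE v : v *m J = \sum_i v 0 i *: partial i f x.
  by rewrite mulmx_sum_row; apply: eq_bigr => i _; rewrite rowK.
pose L : {linear 'rV[R]_n -> 'rV[R]_m} := mulmxr J.
have LE : L = (fun v : 'rV_n => \sum_i v 0 i *: partial i f x) :> ('rV_n -> 'rV_m).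
  by apply/funext => v; rewrite -JE.
have Lc : continuous L.
  rewrite [X in continuous X]LE.
  apply: continuous_big => [|i _ v]; first exact: add_continuous.
  have cv := @coord_continuous R 1 n 0 i v.
  exact: (cvgZr_tmp cv).
suff H (e : R) : 0 < e ->
    nbhs (0 : 'rV[R]_n) [set h : 'rV[R]_n | `|f (h + x) - f x - L h| <= e * `|h|].
  have [dfx dE] := differentiable_near_bound Lc H.
  by split=> // v; rewrite dE LE.
move=> e0.
  (* The sum of the [|h 0 i|] is at most [n] times the sup norm of [h]; dividing by [n.+1] rather
     than [n] covers [n = 0]. *)
  pose e' := e / n.+1%:R.
  have e'0 : 0 < e' by rewrite divr_gt0.
  have /nbhs_ballP[r1 /= r10 hr1] := df.
  have : \forall y \near x, forall i, `|partial i f x - partial i f y| < e'.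
    apply: (@filter_forall _ 'I_n
      (fun i y => `|partial i f x - partial i f y| < e') (nbhs x)) => i.
    by move/cvgrPdist_lt : (cf i) => /(_ _ e'0).
  move=> /nbhs_ballP[r2 /= r20 hr2].
  pose r := Num.min r1 r2.
  have r0 : 0 < r by rewrite lt_min r10.
  apply/nbhs_ballP; exists (r / n.+1%:R) => /=; first by rewrite divr_gt0.
  move=> h; rewrite -ball_normE /= sub0r normrN => hr.
  apply: norm_le_coord => [|j]; first by rewrite mulr_ge0 // ltW.
  have hS : \sum_(i <- enum 'I_n) `|h 0 i| <= n%:R * `|h|.
    have -> : n%:R * `|h| = \sum_(i < n) `|h|.
      by rewrite sumr_const card_ord mulr_natl.
    by rewrite big_enum; apply: ler_sum => i _; exact: coord_le_norm.
  have hS' : n%:R * `|h| <= n.+1%:R * `|h| by rewrite ler_wpM2r // ler_nat.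
  have := @C1_increment _ _ (fun y => f y 0 j) (fun i y => partial i f y 0 j)
    x h r e' (enum 'I_n).
  have <- : h = \sum_(i <- enum 'I_n) h 0 i *: delta_mx 0 i.
    by rewrite big_enum -row_sum_delta.
  have -> : \sum_(i <- enum 'I_n) h 0 i * partial i f x 0 j = (h *m J) 0 j.
    by rewrite big_enum JE summxE; apply: eq_bigr => i _; rewrite mxE.
  have -> : (f (h + x) - f x - L h) 0 j = f (h + x) 0 j - f x 0 j - (h *m J) 0 j.
    by rewrite mxE [X in X + _]mxE [X in _ + X + _]mxE [X in _ + X = _]mxE.
  have H1 i z : `|z - x| < r ->
      is_derive z (delta_mx 0 i) (fun y => f y 0 j) (partial i f z 0 j).
    rewrite lt_min => /andP[z1 _].
    have dfz : derivable f z (delta_mx 0 i).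
      by apply: hr1; rewrite -ball_normE /= distrC.
    exact: (is_derive_coord _ _ _ _).1 (derivableP dfz) j.
  have H2 i z : `|z - x| < r -> `|partial i f z 0 j - partial i f x 0 j| <= e'.
    rewrite lt_min => /andP[_ z2].
    have := hr2 z; rewrite -ball_normE /= distrC => /(_ z2 i) /ltW; apply: le_trans.
    by rewrite distrC; have := coord_le_norm (partial i f x - partial i f z) j; rewrite !mxE.
  have H3 : \sum_(i <- enum 'I_n) `|h 0 i| < r.
    apply: le_lt_trans hS _; apply: le_lt_trans hS' _.
    by rewrite mulrC -ltr_pdivlMr.
  move=> /(_ H1 H2 H3) H; apply: le_trans H _.
  rewrite /e' mulrA ler_pdivrMr // mulrC -mulrA.
  apply: ler_wpM2l; first exact: ltW.
  rewrite [leRHS]mulrC; exact: le_trans hS hS'.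
Qed.

(** * Inner products and second derivatives *)

Section Dotp.
Variables (R : realType) (n : nat).
Implicit Types u v w : 'rV[R]_n.

Lemma dotpC u v : dotp u v = dotp v u.
Proof. by apply: eq_bigr => i _; rewrite mulrC. Qed.

Lemma dotpDl u v w : dotp (u + v) w = dotp u w + dotp v w.
Proof. by rewrite -big_split; apply: eq_bigr => i _; rewrite mxE mulrDl. Qed.

Lemma dotpZl a u v : dotp (a *: u) v = a * dotp u v.
Proof. by rewrite mulr_sumr; apply: eq_bigr => i _; rewrite mxE mulrA. Qed.

Lemma dotpNl u v : dotp (- u) v = - dotp u v.
Proof. by rewrite -scaleN1r dotpZl mulN1r. Qed.

Lemma dotp0l v : dotp 0 v = 0.
Proof. by rewrite -(scale0r 0) dotpZl mul0r. Qed.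

Lemma dotpDr u v w : dotp u (v + w) = dotp u v + dotp u w.
Proof. by rewrite dotpC dotpDl !(dotpC _ u). Qed.

Lemma dotpZr a u v : dotp u (a *: v) = a * dotp u v.
Proof. by rewrite dotpC dotpZl (dotpC v). Qed.

Lemma dotpNr u v : dotp u (- v) = - dotp u v.
Proof. by rewrite dotpC dotpNl (dotpC v). Qed.

Lemma dotp0r v : dotp v 0 = 0.
Proof. by rewrite dotpC dotp0l. Qed.

Lemma dotp_suml (I : finType) (F : I -> 'rV[R]_n) v :
  dotp (\sum_i F i) v = \sum_i dotp (F i) v.
Proof.
elim/big_ind2: _ => [|a b c d <- <-|//]; first by rewrite dotp0l.
by rewrite dotpDl.
Qed.

Lemma dotp_sumr (I : finType) (F : I -> 'rV[R]_n) v :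
  dotp v (\sum_i F i) = \sum_i dotp v (F i).
Proof. by rewrite dotpC dotp_suml; apply: eq_bigr => i _; rewrite dotpC. Qed.

Lemma dotp_ge0 u : 0 <= dotp u u.
Proof. by apply: sumr_ge0 => i _; rewrite -expr2 sqr_ge0. Qed.

Lemma dotp_eq0 u : dotp u u = 0 -> u = 0.
Proof.
move=> /eqP; rewrite psumr_eq0 => [/allP u0|i _]; last by rewrite -expr2 sqr_ge0.
apply/rowP => i; rewrite mxE; apply/eqP.
by have := u0 i (mem_index_enum i); rewrite /= mulf_eq0 orbb.
Qed.

Lemma is_derive_dotp (V : normedModType R) (f g : V -> 'rV[R]_n) (a v : V)
    (df dg : 'rV[R]_n) :
  is_derive a v f df -> is_derive a v g dg ->
  is_derive a v (fun y => dotp (f y) (g y)) (dotp df (g a) + dotp (f a) dg).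
Proof.
move=> /is_derive_coord fd /is_derive_coord gd.
have H i := is_deriveM (fd i) (gd i).
have := is_derive_sum H.
rewrite (_ : \sum_(i < n) _ = (fun y => dotp (f y) (g y))); last first.
  by apply/funext => y; rewrite fct_sumE.
move=> /is_derive_eq; apply.
rewrite /dotp -big_split; apply: eq_bigr => i _ /=.
by rewrite addrC -![_ *: _]/(_ * _) (mulrC (g a 0 i)).
Qed.

Lemma dotp_continuous (T : topologicalType) (f g : T -> 'rV[R]_n) :
  continuous f -> continuous g -> continuous (fun y => dotp (f y) (g y)).
Proof.
move=> fc gc; rewrite /dotp; apply: continuous_big => [|i _ y]; first exact: add_continuous.
apply: (@continuousM _ _ (fun y => f y 0 i) (fun y => g y 0 i)).
  exact: (continuous_comp (fc y) (@coord_continuous R 1 n 0 i (f y))).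
exact: (continuous_comp (gc y) (@coord_continuous R 1 n 0 i (g y))).
Qed.

End Dotp.

(** If [d2] were positive, [dphi], which vanishes at the interior maximum 0, would be positive on
    some []0, m[], and the mean value theorem would give [phi m > phi 0]. *)
Lemma second_derivative_test (R : realType) (phi dphi : R -> R) (d2 : R) :
  (\forall t \near (0 : R), is_derive (t : R) 1 phi (dphi t)) ->
  is_derive (0 : R) 1 dphi d2 ->
  (\forall t \near (0 : R), phi t <= phi 0) ->
  dphi 0 = 0 /\ d2 <= 0.
Proof.
move=> d1 dd2 mx.
have /nbhs_ballP[r /= r0 hr] : \forall t \near (0 : R),
  is_derive (t : R) 1 phi (dphi t) /\ phi t <= phi 0 by near=> t; split; near: t.
have inr (t : R) : t \in `]-r, r[%R -> is_derive t 1 phi (dphi t) /\ phi t <= phi 0.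
  move=> tr; apply: hr; rewrite -ball_normE /= sub0r normrN ltr_norml.
  by move: tr; rewrite in_itv.
have I0 : 0 \in `]-r, r[%R by rewrite in_itv /= r0 oppr_lt0 r0.
have dphi0 : dphi 0 = 0.
  have rr : - r <= r by rewrite ge0_cp // ltW.
  have dvb t : t \in `]-r, r[%R -> derivable phi t 1 by move=> /inr[? _]; exact: ex_derive.
  have := @derive1_at_max _ phi (- r) r 0 rr dvb I0 (fun t tr => (inr t tr).2).
  move=> d0; have [d0' _] := inr 0 I0.
  by rewrite -(@derive_val _ _ _ _ _ _ _ d0') (@derive_val _ _ _ _ _ _ _ d0).
split=> //; rewrite leNgt; apply/negP => d2_gt0.
have : (fun h : R => h^-1 *: (dphi (h *: 1 + 0) - dphi 0)) @ 0^' --> d2.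
  have /cvg_ex[l hl] := @ex_derive _ _ _ _ _ _ _ dd2.
  by rewrite -(@derive_val _ _ _ _ _ _ _ dd2) /derive (cvg_lim _ hl).
move=> /cvgr_gt /(_ _ d2_gt0); rewrite dphi0 => /nbhs_ballP[s /= s0 hs].
pose m := Num.min r s / 2.
have m0 : 0 < m by rewrite divr_gt0 // lt_min r0.
have mrs : m < Num.min r s by rewrite ltr_pdivrMr // mulr2n mulrDr mulr1 ltrDl lt_min r0.
have [mr ms] : m < r /\ m < s by apply/andP; rewrite -lt_min.
have dpos (t : R) : t \in `]0, m[%R -> 0 < dphi t.
  rewrite in_itv /= => /andP[t0 tm].
  have /hs : ball 0 s t.
    by rewrite -ball_normE /= sub0r normrN gtr0_norm // (lt_trans tm).
  rewrite gt_eqF // => /(_ isT).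
  by rewrite subr0 addr0 [t *: 1]mulr1 pmulr_rgt0 ?invr_gt0.
have sub t : t \in `[0, m]%R -> t \in `]-r, r[%R.
  rewrite !in_itv /= => /andP[t0 tm].
  by rewrite (le_lt_trans tm) // andbT (lt_le_trans _ t0) // oppr_lt0.
have dm t : t \in `]0, m[%R -> is_derive t 1 phi (dphi t).
  by move=> /subset_itv_oo_cc /sub /inr[].
have cm : {within `[0, m], continuous phi}.
  by apply: derivable_within_continuous => t /sub /inr[? _]; exact: ex_derive.
have [t tI E] := MVT m0 dm cm.
have mI : m \in `[0, m]%R by rewrite in_itv /= lexx ltW.
have [_] := inr _ (sub _ mI).
by rewrite -subr_le0 E subr0 leNgt mulr_gt0 // dpos.
Unshelve. all: by end_near. Qed.

Lemma smooth_on_partial (R : realType) (n m : nat) (V : set 'rV[R]_n)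
    (f : 'rV[R]_n -> 'rV[R]_m) (i : 'I_n) :
  smooth_on V f -> smooth_on V (partial i f).
Proof.
move=> sf s; have := sf (rcons s i).
by rewrite /iter_partial foldr_rcons.
Qed.

Lemma smooth_on_differentiable (R : realType) (n m : nat) (V : set 'rV[R]_n)
    (f : 'rV[R]_n -> 'rV[R]_m) (x : 'rV[R]_n) :
  open V -> smooth_on V f -> V x ->
  differentiable f x /\ (forall v, 'd f x v = \sum_i v 0 i *: partial i f x).
Proof.
move=> oV sf Vx; apply: C1_differentiable.
  have [_ df] := sf [::].
  by apply: filterS (open_nbhs_nbhs (conj oV Vx)) => y Vy i; exact: df.
by move=> i; have [+ _] := sf [:: i]; apply; rewrite inE.
Qed.

Lemma smooth_on_is_derive (R : realType) (n m : nat) (V : set 'rV[R]_n)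
    (f : 'rV[R]_n -> 'rV[R]_m) (x v : 'rV[R]_n) :
  open V -> smooth_on V f -> V x -> is_derive x v f ('d f x v).
Proof.
move=> oV sf Vx; have [dfx _] := smooth_on_differentiable oV sf Vx.
by rewrite -deriveE //; apply: derivableP; exact: diff_derivable.
Qed.

Lemma smooth_on_second_derive (R : realType) (n m : nat) (V : set 'rV[R]_n)
    (f : 'rV[R]_n -> 'rV[R]_m) (x v : 'rV[R]_n) :
  open V -> smooth_on V f -> V x ->
  exists b, is_derive x v (fun y => 'd f y v) b.
Proof.
move=> oV sf Vx.
(* Near [x], ['d f y v] is the combination of the partial derivatives with the constant coefficients
   [v 0 i], so it can be differentiated termwise. *)
exists (\sum_i v 0 i *: 'd (partial i f) x v).
apply: (@near_eq_is_derive _ _ _ (\sum_i (v 0 i \*: partial i f))).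
  apply: filterS (open_nbhs_nbhs (conj oV Vx)) => y Vy.
  by have [_ ->] := smooth_on_differentiable oV sf Vy; rewrite fct_sumE.
apply: is_derive_sum => i; apply: is_deriveZ.
exact: (smooth_on_is_derive v oV (smooth_on_partial i sf) Vx).
Qed.

(** * Second fundamental form, and curves in a minimal hypersurface *)

Section SecondFundamentalForm.
Variables (R : realType) (n m : nat) (W : set 'rV[R]_n).
Variables (f N : 'rV[R]_n -> 'rV[R]_m).
Hypotheses (oW : open W) (sf : smooth_on W f) (sN : smooth_on W N).
Hypothesis f1 : forall y, W y -> dotp (f y) (f y) = 1.
Hypothesis Nf : forall y, W y -> forall v, dotp (N y) ('d f y v) = 0.

Let derive_near_cst (g : 'rV[R]_n -> R) (c : R) x v dg :
  W x -> (forall y, W y -> g y = c) -> is_derive x v g dg -> dg = 0.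
Proof.
move=> Wx gc dgx.
have : is_derive x v (cst c) dg.
  apply: near_eq_is_derive dgx.
  by apply: filterS (open_nbhs_nbhs (conj oW Wx)) => y Wy; rewrite gc.
by move=> d; rewrite -(@derive_val _ _ _ _ _ _ _ d) derive_cst.
Qed.

Lemma dotp_diff_sphere x v : W x -> dotp (f x) ('d f x v) = 0.
Proof.
move=> Wx; have df := smooth_on_is_derive v oW sf Wx.
have /eqP := derive_near_cst Wx f1 (is_derive_dotp df df).
by rewrite dotpC -mulr2n mulrn_eq0 => /eqP.
Qed.

Lemma dotp_second_derive_sphere x v b : W x ->
  is_derive x v (fun y => 'd f y v) b ->
  dotp (f x) b = - dotp ('d f x v) ('d f x v).
Proof.
move=> Wx db; have df := smooth_on_is_derive v oW sf Wx.
have /eqP := derive_near_cst Wx (fun y Wy => dotp_diff_sphere v Wy) (is_derive_dotp df db).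
by rewrite addrC addr_eq0 => /eqP.
Qed.

(** Weingarten equation: differentiate the orthogonality of [N] and ['d f v] in the direction
    [v]. *)
Lemma dotp_second_derive_normal x v b : W x ->
  is_derive x v (fun y => 'd f y v) b ->
  dotp (N x) b = - dotp ('d N x v) ('d f x v).
Proof.
move=> Wx db; have dN := smooth_on_is_derive v oW sN Wx.
have /eqP := derive_near_cst Wx (fun y Wy => Nf Wy v) (is_derive_dotp dN db).
by rewrite addrC addr_eq0 => /eqP.
Qed.

End SecondFundamentalForm.

(** There are as many orthonormal vectors as dimensions: the square matrix [B] with these rows
    satisfies [B *m B^T = 1], hence also [B^T *m B = 1]. *)
Lemma orthonormal_expansion (R : realType) (n : nat) (x N : 'rV[R]_n.+2)
    (e : 'I_n -> 'rV[R]_n.+2) :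
  dotp x x = 1 -> dotp N N = 1 -> dotp N x = 0 ->
  (forall i, dotp (e i) x = 0) -> (forall i, dotp (e i) N = 0) ->
  (forall i j, dotp (e i) (e j) = (i == j)%:R) ->
  forall w, w = dotp w x *: x + dotp w N *: N + \sum_i dotp w (e i) *: e i.
Proof.
move=> xx NN Nx ex eN ee w.
pose b (i : 'I_n.+2) := if unlift ord0 i is Some j then
  (if unlift ord0 j is Some l then e l else N) else x.
have b0 : b ord0 = x by rewrite /b unlift_none.
have b1 : b (lift ord0 ord0) = N by rewrite /b liftK unlift_none.
have b2 l : b (lift ord0 (lift ord0 l)) = e l by rewrite /b !liftK.
have bb i j : dotp (b i) (b j) = (i == j)%:R.
  case: (unliftP ord0 i) => [i'|] ->; case: (unliftP ord0 j) => [j'|] ->; rewrite ?b0 //.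
  - rewrite (inj_eq lift_inj).
    case: (unliftP ord0 i') => [l|] ->; case: (unliftP ord0 j') => [q|] ->;
      rewrite ?b1 ?b2 ?(inj_eq lift_inj) //.
    by rewrite dotpC.
  - by case: (unliftP ord0 i') => [l|] ->; rewrite ?b1 ?b2.
  - by case: (unliftP ord0 j') => [l|] ->; rewrite ?b1 ?b2 dotpC.
pose B : 'M[R]_n.+2 := \matrix_i b i.
have BB : B *m B^T = 1%:M.
  apply/matrixP => i j; rewrite !mxE -bb.
  by apply: eq_bigr => l _; rewrite !mxE.
rewrite -{1}(mulmx1 w) -(mulmx1C BB) mulmxA mulmx_sum_row.
rewrite (eq_bigr (fun i => dotp w (b i) *: b i)); last first.
  move=> i _; rewrite rowK; congr (_ *: _).
  by rewrite mxE; apply: eq_bigr => l _; rewrite !mxE.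
rewrite !big_ord_recl b0 b1 addrA; congr (_ + _).
by apply: eq_bigr => i _; rewrite b2.
Qed.

(** The left side is the trace of [O *m B *m O^T]. This makes the vanishing of the mean curvature
    independent of the orthonormal frame. *)
Lemma trace_orthogonal (R : comPzRingType) (n : nat) (O B : 'M[R]_n) :
  O *m O^T = 1%:M ->
  \sum_i \sum_j \sum_l O i j * O i l * B j l = \sum_j B j j.
Proof.
move=> OO; rewrite -[RHS]/(\tr B) -[in RHS](mul1mx B) -(mulmx1C OO) -mulmxA.
rewrite mxtrace_mulC; apply: eq_bigr => i _.
rewrite mxE exchange_big; apply: eq_bigr => l _ /=.
by rewrite !mxE mulr_suml; apply: eq_bigr => j _; rewrite mulrAC.
Qed.

(* [e] and [b] are the velocity and the acceleration at [x] of a curve in [A]. *)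
Definition jet2 (R : realType) (m : nat) (A : set 'rV[R]_m) (x e b : 'rV[R]_m) :
    Prop :=
  exists g dg : R -> 'rV[R]_m,
    [/\ forall t, A (g t), g 0 = x, \forall t \near (0 : R), is_derive (t : R) 1 g (dg t),
        dg 0 = e & is_derive (0 : R) 1 dg b].

(** Keeping one point of a pair fixed isolates the first-order condition in the other point. *)
Lemma jet2_cst (R : realType) (m : nat) (A : set 'rV[R]_m) (x : 'rV[R]_m) :
  A x -> jet2 A x 0 0.
Proof.
move=> Ax; exists (cst x), (cst 0); split=> //; last exact: is_derive_cst.
by apply: (@filterE _ (nbhs (0 : R))) => t; exact: is_derive_cst.
Qed.

Lemma smooth_on_subset (R : realType) (n m : nat) (V W : set 'rV[R]_n)
    (f : 'rV[R]_n -> 'rV[R]_m) : W `<=` V -> smooth_on V f -> smooth_on W f.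
Proof.
move=> WV sf s; have [cf df] := sf s; split.
  by move=> x /set_mem Wx; apply: cf; apply/mem_set/WV.
by move=> i x /WV; exact: df.
Qed.

Lemma jet2_line (R : realType) (n m : nat) (W : set 'rV[R]_n)
    (f : 'rV[R]_n -> 'rV[R]_m) (A : set 'rV[R]_m) (x w : 'rV[R]_n) b :
  open W -> smooth_on W f -> W x -> (forall y, A (f y)) ->
  is_derive x w (fun y => 'd f y w) b -> jet2 A (f x) ('d f x w) b.
Proof.
move=> oW sf Wx Af db.
exists (fun t => f (t *: w + x)), (fun t => 'd f (t *: w + x) w); split.
- by move=> t; exact: Af.
- by rewrite scale0r add0r.
- have cl : {for 0, continuous (fun t : R => t *: w + x)}.
    apply: (@continuousD _ _ _ (fun t : R => t *: w) (cst x)).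
      exact: scalel_continuous.
    exact: cst_continuous.
  have Wl : nbhs ((0 : R) *: w + x) W.
    by rewrite scale0r add0r; exact: open_nbhs_nbhs.
  apply: (@filterS _ (nbhs (0 : R)) _ _ _ _ (cl _ Wl)) => t Wt.
  exact: (is_derive_line (smooth_on_is_derive w oW sf Wt)).
- by rewrite scale0r add0r.
- apply: (@is_derive_line _ _ _ (fun y => 'd f y w) x w 0 b).
  by rewrite scale0r add0r.
Qed.

(** Minimality in the form used below: any orthonormal tangent frame [e] consists of velocities of
    curves in the hypersurface whose accelerations add up to [- n *: F p], modulo tangent vectors.
    Each acceleration has component -1 along [F p], the curves being on the sphere, and the
    components along [N0] cancel in total by minimality. The frame [e0] shows that such frames
    exist. *)
Lemma minimal_jets (R : realType) (n : nat) (M : smooth_manifold R n.+1.-1)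
    (F : M -> 'rV[R]_n.+2) (p : M) :
  (0 < n)%N -> minimal_hypersurface F ->
  exists (N0 : 'rV[R]_n.+2) (e0 : 'I_n -> 'rV[R]_n.+2),
  [/\ dotp N0 N0 = 1 /\ dotp N0 (F p) = 0,
      (forall i, dotp (e0 i) (F p) = 0) /\ (forall i, dotp (e0 i) N0 = 0),
      forall i j, dotp (e0 i) (e0 j) = (i == j)%:R &
      forall e : 'I_n -> 'rV[R]_n.+2,
        (forall i, dotp (e i) (F p) = 0) -> (forall i, dotp (e i) N0 = 0) ->
        (forall i j, dotp (e i) (e j) = (i == j)%:R) ->
        exists b : 'I_n -> 'rV[R]_n.+2,
          (forall i, jet2 (range F) (F p) (e i) (b i)) /\
          forall xi, (forall i, dotp xi (e i) = 0) ->
            \sum_i dotp (b i) xi = - n%:R * dotp (F p) xi].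
Proof.
move=> n0 [[Fs Fi] Fm].
have [c [W [N [E [[ac cp] [oW WV Wx] [sN NW] [_ EW] /esym H0]]]]] := Fm p.
set f := F \o chart_inv c in NW EW H0.
set x := chart_map c p in Wx H0.
have sf : smooth_on W f by apply: smooth_on_subset WV _; have [] := Fi c ac.
have fx : f x = F p by rewrite /f /x /= (chart_mapK (mem_set cp)).
have f1 y : W y -> dotp (f y) (f y) = 1 by move=> _; exact: Fs.
have Nf y : W y -> forall v, dotp (N y) ('d f y v) = 0 by move=> /NW[].
have [NN Nfx _] := NW x Wx.
pose e0 i := 'd f x (E i x).
have e0x i : dotp (e0 i) (F p) = 0.
  by rewrite dotpC -fx; exact: (dotp_diff_sphere oW sf f1).
have e0N i : dotp (e0 i) (N x) = 0 by rewrite dotpC; exact: Nf.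
have e0e i j : dotp (e0 i) (e0 j) = (i == j)%:R by exact: EW.
exists (N x), e0; split => //; first by rewrite -fx.
move=> e ex eN ee.
have xx : dotp (F p) (F p) = 1 by exact: Fs.
have Nx : dotp (N x) (F p) = 0 by rewrite -fx.
have expand0 := orthonormal_expansion xx NN Nx e0x e0N e0e.
have expand := orthonormal_expansion xx NN Nx ex eN ee.
(* Both frames span the tangent space, so the change of frame [O] is orthogonal; it also gives the
   coordinate vectors [w i] that ['d f x] maps to [e i]. *)
pose O : 'M[R]_n := \matrix_(i, j) dotp (e i) (e0 j).
have eO i : e i = \sum_j O i j *: e0 j.
  rewrite [LHS]expand0 ex eN !scale0r !add0r.
  by apply: eq_bigr => j _; rewrite mxE.
have OO : O *m O^T = 1%:M.
  apply/matrixP => i j; rewrite !mxE -ee [in RHS](eO j) dotp_sumr.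
  by apply: eq_bigr => l _; rewrite dotpZr !mxE mulrC.
pose w i := \sum_j O i j *: E j x.
have dw i : 'd f x (w i) = e i.
  by rewrite linear_sum eO; apply: eq_bigr => j _; rewrite linearZ.
have /choice[b db] i := smooth_on_second_derive (w i) oW sf Wx.
exists b; split=> [i|xi xie].
  rewrite -fx -dw; apply: (jet2_line oW sf Wx _ (db i)).
  (* Even off the image of the chart, [chart_inv c] takes values in [M], so the curve stays in
     [range F] for all times. *)
  by move=> y; exists (chart_inv c y).
have bx i : dotp (b i) (F p) = -1.
  by rewrite dotpC -fx (dotp_second_derive_sphere oW sf f1 Wx (db i)) !dw ee eqxx.
have bN : \sum_i dotp (b i) (N x) = 0.
  (* The factor [n%:R^-1] is nonzero since [n > 0], and the projection in [sphere_connection] only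
     removes a multiple of [f x], which is orthogonal to [e0 j]. *)
  have trB : \sum_j dotp ('d N x (E j x)) (e0 j) = 0.
    move: H0; rewrite /mean_curvature => /eqP; rewrite mulf_eq0 invr_eq0 pnatr_eq0.
    rewrite gtn_eqF //= => /eqP H1; rewrite -[RHS]H1; apply: eq_bigr => j _.
    have [dN _] := smooth_on_differentiable oW sN Wx.
    rewrite /sphere_connection deriveE // dotpDl dotpNl dotpZl.
    by rewrite (dotp_diff_sphere oW sf f1) // mulr0 subr0.
  rewrite (eq_bigr (fun i => - dotp ('d N x (w i)) (e i))); last first.
    move=> i _; rewrite -(dw i) dotpC.
    exact: (dotp_second_derive_normal oW sN Nf Wx (db i)).
  rewrite sumrN; apply/eqP; rewrite oppr_eq0; apply/eqP.
  pose B : 'M[R]_n := \matrix_(j, l) dotp ('d N x (E j x)) (e0 l).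
  have := trace_orthogonal B OO.
  rewrite [RHS](eq_bigr (fun j => dotp ('d N x (E j x)) (e0 j))); last first.
    by move=> j _; rewrite mxE.
  rewrite trB => H1; rewrite -[RHS]H1; apply: eq_bigr => i _.
  have -> : 'd N x (w i) = \sum_(j < n) O i j *: 'd N x (E j x).
    by rewrite linear_sum; apply: eq_bigr => j _; rewrite linearZ.
  rewrite dotp_suml; apply: eq_bigr => j _.
  rewrite dotpZl eO dotp_sumr mulr_sumr; apply: eq_bigr => l _.
  by rewrite dotpZr mulrA; congr (_ * _); rewrite mxE.
rewrite [in LHS](expand xi).
rewrite (eq_bigr (fun i => - dotp (F p) xi + dotp xi (N x) * dotp (b i) (N x))).
  rewrite big_split /= -mulr_sumr bN mulr0 addr0 sumr_const card_ord.
  by rewrite mulNr mulr_natl mulNrn.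
move=> i _; rewrite [X in _ + X]big1 ?addr0; last by move=> j _; rewrite xie scale0r.
by rewrite dotpDr !dotpZr bx mulrN1 dotpC.
Qed.

(** * Variations of the two-point function *)

Lemma is_derive_dotp_cst (R : realType) (n : nat) (V : normedModType R)
    (f : V -> 'rV[R]_n) (nu : 'rV[R]_n) (a v : V) (df : 'rV[R]_n) :
  is_derive a v f df -> is_derive a v (fun y => dotp (f y) nu) (dotp df nu).
Proof.
move=> fd; have := is_derive_dotp fd (is_derive_cst nu a v).
by rewrite dotp0r addr0.
Qed.

Lemma is_derive_pairing (R : realType) (a b d : R -> R) (c eps t a' b' d' : R) :
  is_derive t 1 a a' -> is_derive t 1 b b' -> is_derive t 1 d d' ->
  is_derive t 1 (fun s => a s + c * ((b s + eps) * (d s + eps)))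
    (a' + c * (b' * (d t + eps) + (b t + eps) * d')).
Proof.
move=> ha hb hd.
have hb1 : is_derive t 1 (b + cst eps) (b' + 0) by exact: is_deriveD.
have hd1 : is_derive t 1 (d + cst eps) (d' + 0) by exact: is_deriveD.
have h := is_deriveD ha (is_deriveZ c (is_deriveM hb1 hd1)).
apply: (is_derive_eq h).
rewrite !addr0 -![_ *: _]/(_ * _) -![(_ + cst _) t]/(_ t + eps); ring.
Qed.

Lemma near_dotp_gt0 (R : realType) (m : nat) (g dg : R -> 'rV[R]_m) nu eps :
  (\forall t \near (0 : R), is_derive (t : R) 1 g (dg t)) ->
  0 < dotp (g 0) nu + eps -> \forall t \near (0 : R), 0 < dotp (g t) nu + eps.
Proof.
move=> hg g0.
have d0 := is_derive_dotp_cst nu (nbhs_singleton hg).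
have c0 : {for 0, continuous (fun t => dotp (g t) nu)}.
  apply/differentiable_continuous/derivable1_diffP.
  exact: (@ex_derive _ _ _ _ _ _ _ d0).
have lt0 : - eps < dotp (g 0) nu by rewrite -subr_gt0 opprK.
have H := cvgr_gt _ c0 _ lt0.
refine (@filterS _ (nbhs (0 : R)) _ _ _ _ (H _)) => t.
by rewrite -subr_gt0 opprK.
Qed.

(** Both points move at once and the one-variable test is applied; by continuity they stay in the
    open cap for small times. [alpha] and [beta] are the gradients in [x] and [y]. As the function
    is affine in each point separately, the only second-order term besides the accelerations is the
    mixed one. *)
Lemma jet2_max (R : realType) (m : nat) (A1 A2 : set 'rV[R]_m)
    (x y nu e1 b1 e2 b2 : 'rV[R]_m) (c eps : R) :
  0 < dotp x nu + eps -> 0 < dotp y nu + eps ->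
  (forall x' y', A1 x' -> A2 y' ->
     0 < dotp x' nu + eps -> 0 < dotp y' nu + eps ->
     dotp x' y' + c * ((dotp x' nu + eps) * (dotp y' nu + eps)) <=
     dotp x y + c * ((dotp x nu + eps) * (dotp y nu + eps))) ->
  jet2 A1 x e1 b1 -> jet2 A2 y e2 b2 ->
  let alpha := y + (c * (dotp y nu + eps)) *: nu in
  let beta := x + (c * (dotp x nu + eps)) *: nu in
  dotp e1 alpha + dotp e2 beta = 0 /\
  dotp b1 alpha + dotp b2 beta + 2 * (dotp e1 e2 + c * (dotp e1 nu * dotp e2 nu)) <= 0.
Proof.
move=> U0 V0 mx [g1 [dg1 [A1g gx hg1 e1E hb1]]] [g2 [dg2 [A2g gy hg2 e2E hb2]]].
move=> alpha beta; rewrite -gx in U0 mx; rewrite -gy in V0 mx.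
pose u1 t := dotp (g1 t) nu; pose u2 t := dotp (g2 t) nu.
pose du1 t := dotp (dg1 t) nu; pose du2 t := dotp (dg2 t) nu.
pose phi (t : R) := dotp (g1 t) (g2 t) + c * ((u1 t + eps) * (u2 t + eps)).
pose dphi (t : R) := (dotp (dg1 t) (g2 t) + dotp (g1 t) (dg2 t)) +
  c * (du1 t * (u2 t + eps) + (u1 t + eps) * du2 t).
pose d2 := (dotp b1 y + dotp e1 e2 + (dotp e1 e2 + dotp x b2)) +
  c * (dotp b1 nu * (u2 0 + eps) + du1 0 * du2 0 +
    (du1 0 * du2 0 + (u1 0 + eps) * dotp b2 nu)).
have dphiP : \forall t \near (0 : R), is_derive (t : R) 1 phi (dphi t).
  apply: (@filterS2 _ (nbhs (0 : R)) _ _ _ _ _ hg1 hg2) => t h1 h2.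
  apply: is_derive_pairing; [exact: is_derive_dotp|exact: is_derive_dotp_cst|].
  exact: is_derive_dotp_cst.
have g10 := nbhs_singleton hg1; have g20 := nbhs_singleton hg2.
have d2P : is_derive (0 : R) 1 dphi d2.
  have h1 := is_deriveD (is_derive_dotp hb1 g20) (is_derive_dotp g10 hb2).
  have h2 : is_derive (0 : R) 1 (u2 + cst eps) (du2 0 + 0).
    by apply: is_deriveD; exact: is_derive_dotp_cst.
  have h3 : is_derive (0 : R) 1 (u1 + cst eps) (du1 0 + 0).
    by apply: is_deriveD; exact: is_derive_dotp_cst.
  have h4 := is_deriveM (is_derive_dotp_cst nu hb1) h2.
  have h5 := is_deriveM h3 (is_derive_dotp_cst nu hb2).
  apply: (is_derive_eq (is_deriveD h1 (is_deriveZ c (is_deriveD h4 h5)))).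
  rewrite /d2 !addr0 -![_ *: _]/(_ * _) -![(_ + cst _) 0]/(_ 0 + eps).
  by rewrite /du1 /du2 /cst gx gy e1E e2E; ring.
have mxP : \forall t \near (0 : R), phi t <= phi 0.
  apply: (@filterS2 _ (nbhs (0 : R)) _ _ _ _ _ (near_dotp_gt0 hg1 U0)
    (near_dotp_gt0 hg2 V0)) => t p1 p2.
  exact: mx.
have [] := second_derivative_test dphiP d2P mxP.
rewrite /dphi /d2 /alpha /beta /du1 /du2 /u1 /u2 gx gy e1E e2E => <- d2le.
split.
  by rewrite !dotpDr !dotpZr (dotpC x e2); ring.
apply: le_trans d2le; rewrite le_eqVlt; apply/orP; left; apply/eqP.
by rewrite !dotpDr !dotpZr (dotpC x b2); ring.
Qed.

(** * The two-point maximum principle *)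

Lemma minimal_hypersurface_continuous (R : realType) (k : nat)
    (M : smooth_manifold R k.-1) (F : M -> 'rV[R]_k.+1) :
  minimal_hypersurface F -> continuous F.
Proof.
move=> [[_ Fi] _] p; have [c ac cp] := atlas_cover p.
have [sf _] := Fi c ac; have [fc _] := sf [::].
have cm : chart_img c (chart_map c p) by have [+ _ _] := chart_map_bij c; apply.
have cc : {for p, continuous ((F \o chart_inv c) \o chart_map c)}.
  apply: continuous_comp; first exact: (chart_map_continuous (mem_set cp)).
  exact: (fc _ (mem_set cm)).
have nE : \forall q \near p, ((F \o chart_inv c) \o chart_map c) q = F q.
  apply: filterS (open_nbhs_nbhs (conj (chart_dom_open c) cp)) => q cq /=.
  by rewrite (chart_mapK (mem_set cq)).
rewrite /continuous_at -[X in _ --> X](nbhs_singleton nE).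
exact: cvg_trans (near_eq_cvg nE) cc.
Qed.

(** At a maximum of the height [dotp (F p) nu], [nu] is orthogonal to the tangent frame, so the
    trace formula of [minimal_jets] applies to [xi := nu]. *)
Lemma minimal_meets_hemisphere (R : realType) (n : nat)
    (M : smooth_manifold R n.+1.-1) (F : M -> 'rV[R]_n.+2) (nu : 'rV[R]_n.+2) :
  (0 < n)%N -> compact [set: M] -> minimal_hypersurface F ->
  exists p, 0 <= dotp (F p) nu.
Proof.
move=> n0 cM mF.
have Fc := minimal_hypersurface_continuous mF.
have uc : continuous (fun p => dotp (F p) nu).
  by apply: dotp_continuous => //; exact: cst_continuous.
have [p _ pmax] := compact_EVT_max (manifold_nonempty M) cM (continuous_subspaceT uc).
exists p.
have [N0 [e [[NN Nx] [ex eN] ee jets]]] := minimal_jets p n0 mF.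
have [b [jb trb]] := jets e ex eN ee.
have test i : dotp (e i) nu = 0 /\ dotp (b i) nu <= 0.
  have [g [dg [Ag gp hg <- hb]]] := jb i.
  apply: (@second_derivative_test _ (fun t => dotp (g t) nu) (fun t => dotp (dg t) nu)).
  - by apply: (@filterS _ (nbhs (0 : R)) _ _ _ _ hg) => t; exact: is_derive_dotp_cst.
  - exact: is_derive_dotp_cst.
  - apply: (@filterE _ (nbhs (0 : R))) => t.
    by have [q _ <-] := Ag t; rewrite gp; apply: pmax; exact: mem_set.
have := trb nu (fun i => etrans (dotpC _ _) (test i).1).
have : \sum_i dotp (b i) nu <= 0 by apply: sumr_le0 => i _; have [] := test i.
by move=> /[swap] ->; rewrite mulNr oppr_le0 pmulr_rge0 // ltr0n.
Qed.

Lemma dotp_unit_eq (R : realType) (m : nat) (x y : 'rV[R]_m) :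
  dotp x x = 1 -> dotp y y = 1 -> 1 <= dotp x y -> x = y.
Proof.
move=> xx yy xy; apply/eqP; rewrite -subr_eq0; apply/eqP/dotp_eq0/eqP.
rewrite eq_le dotp_ge0 andbT dotpDl !dotpDr !dotpNl !dotpNr xx yy (dotpC y).
lra.
Qed.

Lemma no_interior_max (R : realType) (n : nat) (M1 M2 : smooth_manifold R n.+1.-1)
    (F1 : M1 -> 'rV[R]_n.+2) (F2 : M2 -> 'rV[R]_n.+2) (p : M1) (q : M2)
    (nu : 'rV[R]_n.+2) (c eps : R) :
  (0 < n)%N -> minimal_hypersurface F1 -> minimal_hypersurface F2 ->
  dotp nu nu = 1 -> 0 < eps -> eps <= 1 -> 0 < c ->
  0 < dotp (F1 p) nu + eps -> 0 < dotp (F2 q) nu + eps ->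
  dotp (F1 p) (F2 q) + c * ((dotp (F1 p) nu + eps) * (dotp (F2 q) nu + eps)) = 1 ->
  (forall x y, range F1 x -> range F2 y ->
     0 < dotp x nu + eps -> 0 < dotp y nu + eps ->
     dotp x y + c * ((dotp x nu + eps) * (dotp y nu + eps)) <= 1) -> False.
Proof.
move=> n0 mF1 mF2 nn eps0 eps1 c0.
set x := F1 p; set y := F2 q; set u := dotp x nu; set v := dotp y nu; set s := dotp x y.
set U := u + eps; set V := v + eps => U0 V0 sE gmax.
have {}sE : s = 1 - c * (U * V) by rewrite -sE addrK.
have xx : dotp x x = 1 by have [[+ _] _] := mF1; apply.
have yy : dotp y y = 1 by have [[+ _] _] := mF2; apply.
pose al := y + (c * V) *: nu; pose be := x + (c * U) *: nu.
have mx x' y' : range F1 x' -> range F2 y' ->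
     0 < dotp x' nu + eps -> 0 < dotp y' nu + eps ->
     dotp x' y' + c * ((dotp x' nu + eps) * (dotp y' nu + eps)) <=
     dotp x y + c * ((dotp x nu + eps) * (dotp y nu + eps)).
  by rewrite -/s sE -/u -/v -/U -/V subrK; exact: gmax.
have test := jet2_max U0 V0 mx; rewrite -/u -/v -/U -/V -/al -/be in test.
have [N1 [e [[_ _] [ex eN1] ee jets1]]] := minimal_jets p n0 mF1.
have [N2 [f [[NN2 Ny2] [fy fN2] ff jets2]]] := minimal_jets q n0 mF2.
have [b1 [jb1 tr1]] := jets1 e ex eN1 ee.
have [b2' [jb2' _]] := jets2 f fy fN2 ff.
have xr : range F1 x by exists p.
have yr : range F2 y by exists q.
(* First-order conditions, moving one point at a time. The frame [f] serves only to obtain the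
   condition at [y]; the second variation uses another frame there. *)
have eal i : dotp (e i) al = 0.
  have [+ _] := test _ _ _ _ (jb1 i) (jet2_cst yr).
  by rewrite dotp0l addr0.
have fbe i : dotp be (f i) = 0.
  have [+ _] := test _ _ _ _ (jet2_cst xr) (jb2' i).
  by rewrite dotp0l add0r dotpC.
have beE : be = dotp be y *: y + dotp be N2 *: N2.
  rewrite [LHS](orthonormal_expansion yy NN2 Ny2 fy fN2 ff) [X in _ + X]big1 ?addr0 //.
  by move=> i _; rewrite fbe scale0r.
(* Otherwise [be] would be a multiple of the unit vector [y]. But [dotp be be] exceeds the square of
   [dotp be y = 1 - c * U * eps] by [U ^+ 2 * c * (2 + c * (1 - eps ^+ 2))], positive as
   [eps <= 1]. *)
have beN : dotp be N2 != 0.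
  apply/eqP => b0; move: beE; rewrite b0 scale0r addr0 => beE.
  have : dotp be be = dotp be y * dotp be y by rewrite [in LHS]beE dotpZl dotpZr yy; ring.
  rewrite /be !dotpDl !dotpDr !dotpZl !dotpZr (dotpC nu x) (dotpC nu y) xx nn -/u -/v -/s sE.
  have -> : u = U - eps by rewrite /U addrK.
  have -> : v = V - eps by rewrite /V addrK.
  have : 0 < U ^+ 2 * c * (2 + c * (1 - eps ^+ 2)).
    apply: mulr_gt0; first by rewrite mulr_gt0 // exprn_gt0.
    have : 0 <= c * (1 - eps ^+ 2).
      by rewrite mulr_ge0 ?(ltW c0) // subr_ge0 expr_le1 // ltW.
    lra.
  move=> pos /eqP; rewrite -subr_eq0 => /eqP E0.
  suff E : U ^+ 2 * c * (2 + c * (1 - eps ^+ 2)) = 0 by rewrite E ltxx in pos.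
  by rewrite -[RHS]E0; ring.
(* This is the coefficient of the reflection, twice [dotp (e i) (x - y)] over the squared length of
   [x - y]: the former product is [c * V * dotp (e i) nu] by [eal], and the squared length is
   [2 * c * U * V]. *)
pose w i := dotp (e i) nu / U.
have gE i : dotp (e i) nu = w i * U by rewrite /w divfK // gt_eqF.
have aE i : dotp (e i) y = - (c * (U * V) * w i).
  by have := eal i; rewrite /al dotpDr dotpZr gE => ?; lra.
(* As [e i] is orthogonal to [al], [e' i] is its image under the reflection
   exchanging [x] and [y]. *)
pose e' i := e i - w i *: (x - y).
have dE' z i : dotp (e' i) z = dotp (e i) z - w i * (dotp x z - dotp y z).
  by rewrite /e' dotpDl dotpNl dotpZl dotpDl dotpNl.
have e'y i : dotp (e' i) y = 0 by rewrite dE' aE yy -/s sE; ring.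
have e'nu i : dotp (e' i) nu = w i * V.
  by rewrite dE' gE -/u -/v /U /V; ring.
have e'x i : dotp (e' i) x = - (c * (U * V) * w i).
  by rewrite dE' ex xx (dotpC y) -/s sE; ring.
have e'be i : dotp (e' i) be = 0.
  by rewrite /be dotpDr dotpZr e'x e'nu; ring.
(* [e' i] is orthogonal to [y] and to [be], and [be] lies in the span of [y] and [N2] with a nonzero
   [N2] component; hence [e' i] is tangent to the second hypersurface. *)
have e'N i : dotp (e' i) N2 = 0.
  have := e'be i; rewrite beE dotpDr !dotpZr e'y mulr0 add0r => /eqP.
  by rewrite mulf_eq0 (negbTE beN) => /eqP.
have ee' i j : dotp (e' i) (e j) = dotp (e i) (e j) - c * (U * V) * w i * w j.
  by rewrite dE' (dotpC x) (dotpC y) ex aE; ring.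
have e'e' i j : dotp (e' i) (e' j) = (i == j)%:R.
  rewrite [LHS]dotpC dE' (dotpC (e j)) (dotpC x) (dotpC y) e'x e'y ee' ee; ring.
have [b2 [jb2 tr2]] := jets2 e' e'y e'N e'e'.
have : \sum_i (dotp (b1 i) al + dotp (b2 i) be +
    2 * (dotp (e i) (e' i) + c * (dotp (e i) nu * dotp (e' i) nu))) <= 0.
  by apply: sumr_le0 => i _; have [] := test _ _ _ _ (jb1 i) (jb2 i).
(* The mixed term is exactly 1: [dotp (e i) (e' i)] loses [c * U * V * w i ^+ 2], which the product
   of the heights restores. *)
rewrite (eq_bigr (fun i => dotp (b1 i) al + dotp (b2 i) be + 2)); last first.
  by move=> i _; rewrite (dotpC (e i)) ee' ee eqxx mulr1n gE e'nu; ring.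
rewrite !big_split /= tr1; last by move=> i; rewrite dotpC eal.
rewrite tr2; last by move=> i; rewrite dotpC e'be.
rewrite sumr_const card_ord -/x -/y /al /be !dotpDr !dotpZr (dotpC y x) -/s -/u -/v.
rewrite -mulr_natl => H.
have : 0 < n%:R * (c * eps * (U + V)).
  by rewrite !mulr_gt0 ?ltr0n // addr_gt0.
suff : n%:R * (c * eps * (U + V)) <= 0 by move=> /le_lt_trans h /h; rewrite ltxx.
apply: le_trans H; rewrite le_eqVlt; apply/orP; left; apply/eqP.
by rewrite sE /U /V; ring.
Qed.

Lemma compact_disjoint_margin (R : realType) (m : nat) (T1 T2 : topologicalType)
    (F1 : T1 -> 'rV[R]_m) (F2 : T2 -> 'rV[R]_m) (nu : 'rV[R]_m) :
  compact [set: T1] -> compact [set: T2] -> continuous F1 -> continuous F2 ->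
  (forall p q, F1 p = F2 q -> dotp (F1 p) nu < 0) ->
  exists eps : R, [/\ 0 < eps, eps <= 1 &
    forall p q, F1 p = F2 q -> dotp (F1 p) nu + eps < 0].
Proof.
move=> c1 c2 F1c F2c neg.
have f1c : continuous (fun z : T1 * T2 => F1 z.1).
  by move=> z; apply: continuous_comp; [exact: cvg_fst|exact: F1c].
have f2c : continuous (fun z : T1 * T2 => F2 z.2).
  by move=> z; apply: continuous_comp; [exact: cvg_snd|exact: F2c].
have dc : continuous (fun z : T1 * T2 => F1 z.1 - F2 z.2).
  by move=> z; exact: (continuousB (f1c z) (f2c z)).
pose C := [set z : T1 * T2 | F1 z.1 = F2 z.2].
have CE : C = (fun z : T1 * T2 => dotp (F1 z.1 - F2 z.2) (F1 z.1 - F2 z.2)) @^-1`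
    [set r | r = 0].
  apply/seteqP; split=> z /=; first by rewrite /C /= => ->; rewrite subrr dotp0l.
  by move=> /dotp_eq0 /subr0_eq.
(* The coincident pairs are the zeros of a continuous function on a compact product, so the height
   attains its maximum on them, and this maximum is negative. *)
have cC : compact C.
  apply: (@subclosed_compact _ _ ([set: T1] `*` [set: T2])) => //; last first.
    exact: compact_setX.
  rewrite CE; apply: closed_comp; last exact: closed_eq.
  by move=> z _; exact: (dotp_continuous dc dc).
have [C0|/set0P C0] := eqVneq C set0.
  exists 1; split=> // p q E.
  by have : C (p, q) by []; rewrite C0.
have uc : continuous (fun z : T1 * T2 => dotp (F1 z.1) nu).
  by apply: dotp_continuous => //; exact: cst_continuous.
have [[p q] /set_mem /= Cpq pqmax] := compact_EVT_max C0 cC (continuous_subspaceT uc).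
have lt0 := neg p q Cpq.
(* Half of the gap below 0 keeps the final inequality strict. *)
exists (Num.min 1 (- dotp (F1 p) nu / 2)); split.
- by rewrite lt_min ltr01 /=; lra.
- by rewrite ge_min lexx.
- move=> p' q' E.
  have /= le0 : dotp (F1 (p', q').1) nu <= dotp (F1 (p, q).1) nu.
    by apply: pqmax; exact: mem_set.
  have : Num.min 1 (- dotp (F1 p) nu / 2) <= - dotp (F1 p) nu / 2.
    by rewrite ge_min lexx orbT.
  lra.
Qed.

Unset Implicit Arguments.

Theorem theorem2 (R : realType) (k : nat) (hk : (2 <= k)%N)
    (M1 M2 : smooth_manifold R k.-1)
    (F1 : M1 -> 'rV[R]_k.+1) (F2 : M2 -> 'rV[R]_k.+1)
    (cM1 : compact [set: M1]) (cM2 : compact [set: M2])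
    (minF1 : minimal_hypersurface F1) (minF2 : minimal_hypersurface F2)
    (nu : 'rV[R]_k.+1) (hnu : usphere nu) :
  (range F1 `&` range F2 `&` closed_hemisphere nu) !=set0.
Proof.
case: k hk M1 M2 F1 F2 cM1 cM2 minF1 minF2 nu hnu => // n n0.
move=> M1 M2 F1 F2 cM1 cM2 mF1 mF2 nu nn; rewrite ltnS in n0.
apply: contrapT => disj.
have F1c := minimal_hypersurface_continuous mF1.
have F2c := minimal_hypersurface_continuous mF2.
have s1 p : dotp (F1 p) (F1 p) = 1 by have [[+ _] _] := mF1; apply.
have s2 q : dotp (F2 q) (F2 q) = 1 by have [[+ _] _] := mF2; apply.
have neg p q : F1 p = F2 q -> dotp (F1 p) nu < 0.
  move=> E; rewrite ltNge; apply/negP => u0; apply: disj.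
  exists (F1 p); split; last by split => //; exact: s1.
  by split; [exists p|exists q].
have [eps [eps0 eps1 sep]] := compact_disjoint_margin cM1 cM2 F1c F2c neg.
pose U p := dotp (F1 p) nu + eps; pose V q := dotp (F2 q) nu + eps.
have Uc : continuous U.
  move=> p; apply: (@continuousD _ _ _ (fun p => dotp (F1 p) nu) (cst eps)).
    by apply: dotp_continuous => //; exact: cst_continuous.
  exact: cst_continuous.
have Vc : continuous V.
  move=> q; apply: (@continuousD _ _ _ (fun q => dotp (F2 q) nu) (cst eps)).
    by apply: dotp_continuous => //; exact: cst_continuous.
  exact: cst_continuous.
have cpt (T : topologicalType) (h : T -> R) : compact [set: T] -> continuous h ->
    compact [set t | 0 <= h t].
  move=> cT hc; apply: (subclosed_compact _ cT) => //.
  apply: (@closed_comp _ _ h [set r | 0 <= r]); last exact: closed_ge.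
  by move=> t _; exact: hc.
pose K := [set p | 0 <= U p] `*` [set q | 0 <= V q].
have cK : compact K by apply: compact_setX; exact: cpt.
have [p1 u1] := minimal_meets_hemisphere nu n0 cM1 mF1.
have [q1 v1] := minimal_meets_hemisphere nu n0 cM2 mF2.
have U1 : 0 < U p1 by rewrite /U; lra.
have V1 : 0 < V q1 by rewrite /V; lra.
have K1 : K (p1, q1) by split; exact: ltW.
pose D (z : M1 * M2) := 1 - dotp (F1 z.1) (F2 z.2).
(* Unit vectors with inner product at least 1 coincide, and the choice of [eps] excludes
   coincidences in the closed cap. *)
have Dpos z : K z -> 0 < D z.
  move=> [/= U0 _]; rewrite subr_gt0 ltNge; apply/negP => le1.
  have := sep _ _ (dotp_unit_eq (s1 _) (s2 _) le1).
  by rewrite ltNge => /negP; apply.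
have Dc : continuous D.
  have dc : continuous (fun z : M1 * M2 => dotp (F1 z.1) (F2 z.2)).
    apply: dotp_continuous => z.
      by apply: continuous_comp; [exact: cvg_fst|exact: F1c].
    by apply: continuous_comp; [exact: cvg_snd|exact: F2c].
  by move=> z; exact: (continuousB (@cst_continuous _ _ (1 : R) z) (dc z)).
(* The inverse of the ratio to be minimised: it vanishes on the boundary of the cap instead of
   blowing up, so it is continuous on the compact set [K] and attains its maximum. *)
pose Q (z : M1 * M2) := U z.1 * V z.2 / D z.
have Qc : {within K, continuous Q}.
  apply: continuous_in_subspaceT => z /set_mem Kz.
  apply: (@continuousM _ _ (fun z => U z.1 * V z.2) (fun z => (D z)^-1)).
    apply: (@continuousM _ _ (fun z => U z.1) (fun z => V z.2)).
      by apply: continuous_comp; [exact: cvg_fst|exact: Uc].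
    by apply: continuous_comp; [exact: cvg_snd|exact: Vc].
  by apply: continuousV; [rewrite gt_eqF // Dpos|exact: Dc].
have [[p q] /set_mem Kpq pqmax] := compact_EVT_max (ex_intro _ _ K1) cK Qc.
have Q0 : 0 < Q (p, q).
  apply: lt_le_trans (pqmax _ (mem_set K1)).
  by rewrite divr_gt0 ?mulr_gt0 // Dpos.
have D0 := Dpos _ Kpq.
have [/= Up0 Vq0] := Kpq.
(* A positive maximum of [Q] forces the maximising pair into the open cap. *)
have UV0 : 0 < U p * V q by have := Q0; rewrite pmulr_lgt0 // invr_gt0.
have Up : 0 < U p.
  by rewrite lt0r Up0 andbT; apply: contraTneq UV0 => ->; rewrite mul0r ltxx.
have Vq : 0 < V q by move: UV0; rewrite pmulr_rgt0.
pose c := (Q (p, q))^-1.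
have c0 : 0 < c by rewrite invr_gt0.
apply: (@no_interior_max _ _ _ _ F1 F2 p q nu c eps) => //.
  by rewrite -/(U p) -/(V q) /c /Q invf_div /= divfK ?gt_eqF // /D /= subrKC.
move=> _ _ [p' _ <-] [q' _ <-] U0 V0.
have K' : K (p', q') by split; exact: ltW.
have := pqmax _ (mem_set K').
(* Maximality of [Q (p, q)] reads [c * (U p' * V q') <= D (p', q')], which is the required bound by
   1. *)
rewrite /Q ler_pdivrMr ?Dpos // -/(Q (p, q)) -ler_pdivrMl // -/c.
by rewrite -/(U p') -/(V q') /D /= => h; lra.
Qed.
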